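(* Let $d\ge 1$, let $I\subset\mathbb{R}$ be an open interval, and let $X:I\times\mathbb{R}\to\mathbb{R}^d$, $(t,s)\mapsto X(t,s)$, be a $C^2$ solution of the relativistic string equation $$\partial_t\big(B\,\partial_tX-C\,\partial_sX\big)-\partial_s\big(C\,\partial_tX+D\,\partial_sX\big)=0,$$ where $$B=\frac{1+|\partial_sX|^2}{A},\quad C=\frac{\partial_tX\cdot\partial_sX}{A},\quad D=\frac{1-|\partial_tX|^2}{A},$$ $$A=\sqrt{(1+|\partial_sX|^2)(1-|\partial_tX|^2)+(\partial_tX\cdot\partial_sX)^2},$$ the quantity under the square root being positive everywhere. Set $Y=\partial_sX$, $W=-\partial_tX$, $L=-\sqrt{(1+|Y|^2)(1-|W|^2)+(Y\cdot W)^2}$, and $$\tau=\frac{-L}{1+|Y|^2},\qquad v=\frac{Y\cdot W}{1+|Y|^2},\qquad \eta=\frac{-L}{1+|Y|^2}\,Y,\qquad \zeta=W-\frac{Y\cdot W}{1+|Y|^2}\,Y .$$ Then $(\tau,v,\eta,\zeta)$ is a solution on $I\times\mathbb{R}$ of the augmented system $$\partial_t\tau+v\,\partial_s\tau=\tau\,\partial_sv,\qquad \partial_tv+v\,\partial_sv=\tau\,\partial_s\tau,$$ $$\partial_t\eta+v\,\partial_s\eta=-\tau\,\partial_s\zeta,\qquad \partial_t\zeta+v\,\partial_s\zeta=-\tau\,\partial_s\eta,$$ and in addition satisfies $$\tau>0,\qquad \tau^2+v^2+|\eta|^2+|\zeta|^2=1,\qquad \tau v=\eta\cdot\zeta .$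$
   Context: The dot denotes the Euclidean inner product of $\mathbb{R}^d$ and $|\cdot|$ the Euclidean norm. The functions $\tau,v$ are real valued, while $Y,W,\eta,\zeta$ are $\mathbb{R}^d$-valued. *)

(* Defs.v *)
From HB Require Import structures.
From mathcomp Require Import all_boot all_order all_algebra.
From mathcomp Require Import all_classical all_reals all_analysis.
Set Implicit Arguments.
Unset Strict Implicit.
Unset Printing Implicit Defensive.
Import Order.TTheory GRing.Theory Num.Theory.
Import numFieldNormedType.Exports.
Local Open Scope classical_set_scope.
Local Open Scope ring_scope.

(* The norm `|u| of the library on 'rV[R]_d is the sup norm, hence [enorm]. *)
Definition dot (R : realType) (d : nat) (u v : 'rV[R]_d) : R :=
  \sum_(i < d) u 0 i * v 0 i.

Definition enorm (R : realType) (d : nat) (u : 'rV[R]_d) : R :=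
  Num.sqrt (dot u u).

Section PartialDerivatives.
Variables (R : realType) (V : normedModType R).
Implicit Types (f : R -> R -> V) (I : set R).

Definition dt f (t s : R) : V := derive1 (fun t' => f t' s) t.

Definition ds f (t s : R) : V := derive1 (fun s' => f t s') s.

(* Joint continuity of f on I x R is not required: it follows. *)
Definition C1_on I f : Prop :=
  forall t s, I t ->
    [/\ derivable (fun t' => f t' s) t 1,
        derivable (fun s' => f t s') s 1,
        {for (t, s), continuous (fun p : R * R => dt f p.1 p.2)} &
        {for (t, s), continuous (fun p : R * R => ds f p.1 p.2)}].

Definition C2_on I f : Prop :=
  [/\ C1_on I f, C1_on I (dt f) & C1_on I (ds f)].

End PartialDerivatives.

Section String.
Variables (R : realType) (d : nat) (X : R -> R -> 'rV[R]_d).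

Definition radicand t s : R :=
  (1 + enorm (ds X t s) ^+ 2) * (1 - enorm (dt X t s) ^+ 2)
  + dot (dt X t s) (ds X t s) ^+ 2.

Definition coefA t s : R := Num.sqrt (radicand t s).
Definition coefB t s : R := (1 + enorm (ds X t s) ^+ 2) / coefA t s.
Definition coefC t s : R := dot (dt X t s) (ds X t s) / coefA t s.
Definition coefD t s : R := (1 - enorm (dt X t s) ^+ 2) / coefA t s.

Definition string_equation (I : set R) : Prop :=
  forall t s, I t ->
    dt (fun t' s' => coefB t' s' *: dt X t' s' - coefC t' s' *: ds X t' s') t s
    - ds (fun t' s' => coefC t' s' *: dt X t' s' + coefD t' s' *: ds X t' s') t s
    = 0.

Definition string_Y t s : 'rV[R]_d := ds X t s.

Definition string_W t s : 'rV[R]_d := - dt X t s.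

Definition string_L t s : R :=
  - Num.sqrt ((1 + enorm (string_Y t s) ^+ 2) * (1 - enorm (string_W t s) ^+ 2)
              + dot (string_Y t s) (string_W t s) ^+ 2).

Definition string_tau t s : R :=
  - string_L t s / (1 + enorm (string_Y t s) ^+ 2).

Definition string_v t s : R :=
  dot (string_Y t s) (string_W t s) / (1 + enorm (string_Y t s) ^+ 2).

Definition string_eta t s : 'rV[R]_d :=
  (- string_L t s / (1 + enorm (string_Y t s) ^+ 2)) *: string_Y t s.

Definition string_zeta t s : 'rV[R]_d :=
  string_W t s
  - (dot (string_Y t s) (string_W t s) / (1 + enorm (string_Y t s) ^+ 2))
    *: string_Y t s.

End String.

(* [dt] and [ds] are total, so a classical solution also needs C^1 regularity. *)
Definition augmented_solution (R : realType) (d : nat) (I : set R)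
    (tau v : R -> R -> R) (eta zeta : R -> R -> 'rV[R]_d) : Prop :=
  [/\ C1_on I tau, C1_on I v, C1_on I eta & C1_on I zeta] /\
  forall t s, I t ->
    [/\ dt tau t s + v t s * ds tau t s = tau t s * ds v t s,
        dt v t s + v t s * ds v t s = tau t s * ds tau t s,
        dt eta t s + v t s *: ds eta t s = - (tau t s *: ds zeta t s) &
        dt zeta t s + v t s *: ds zeta t s = - (tau t s *: ds eta t s)].

(* Main.v *)
Require Import Defs.
From HB Require Import structures.
From mathcomp Require Import all_boot all_order all_algebra.
From mathcomp Require Import all_classical all_reals all_analysis.
From mathcomp Require Import ring lra.
Set Implicit Arguments.
Unset Strict Implicit.
Unset Printing Implicit Defensive.
Import Order.TTheory GRing.Theory Num.Theory.
Import numFieldNormedType.Exports.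
Local Open Scope classical_set_scope.
Local Open Scope ring_scope.

(* With rho = 1 / tau one has Y = rho eta and W = zeta + v Y, so Schwarz's
   theorem (Y_t + W_s = 0) and the string equation become the conservation laws
     (rho eta)_t + (zeta + v rho eta)_s = 0,
     (rho zeta)_t + (v rho zeta + eta)_s = 0.
   Put D = d_t + v d_s and let k be defined by D tau - tau v_s = tau k; the two
   laws say D eta + tau zeta_s = k eta and D zeta + tau eta_s = k zeta.
   Contracting them with eta and zeta and inserting the t- and s-derivatives
   of the two algebraic constraints gives D v - tau tau_s = k v and then
   k (tau^2 + v^2 + |eta|^2 + |zeta|^2) = 0, that is k = 0. *)

(** * Mean value estimates in one and two variables *)

(** The mean value theorem applies on the segment between [c] and [y], which stays in the ball; the
    estimate is symmetric, so both orders of [c] and [y] reduce to a segment [a <= b]. *)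
Lemma mvt_le (R : realType) (f df : R -> R) (c r M : R) :
  (forall x, `|c - x| < r -> is_derive x 1 f (df x) /\ `|df x| <= M) ->
  forall y, `|c - y| < r -> `|f c - f y| <= M * `|c - y|.
Proof.
move=> fM.
suff H a b : a <= b -> (forall x, a <= x <= b -> `|c - x| < r) ->
    `|f b - f a| <= M * `|b - a|.
  move=> y cy; case: (leP c y) => [cley|/ltW ylec].
    rewrite distrC (distrC c); apply: H => // x /andP[cx xy].
    by apply: le_lt_trans cy; rewrite !ler0_norm ?subr_le0//; lra.
  apply: H => // x /andP[cx xy].
  by apply: le_lt_trans cy; rewrite !ger0_norm ?subr_ge0//; lra.
move=> ab abr.
have drv x : x \in `[a, b] -> is_derive x 1 f (df x).
  by rewrite in_itv/= => /abr/fM[].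
have drvo x (xab : x \in `]a, b[) := drv x (subset_itv_oo_cc xab).
have cf : {within `[a, b], continuous f}.
  by apply: derivable_within_continuous => x /drv[].
have [e] := MVT_segment ab drvo cf; rewrite in_itv/= => /abr/fM[_ dM] ->.
by rewrite normrM ler_wpM2r.
Qed.

(** The second difference over a square is the increment in [s] of [f (t + h) - f t]. One mean value
    theorem turns it into an increment in [t] of [fs] at a fixed [s'], and a second one produces
    [fst]. *)
Lemma double_difference_mvt (R : realType) (f fs fst : R -> R -> R) (t s h : R) :
  0 <= h ->
  (forall t' s', t' \in `[t, t + h] -> s' \in `[s, s + h] ->
    is_derive s' 1 (f t') (fs t' s') /\
    is_derive t' 1 (fs^~ s') (fst t' s')) ->
  exists t' s', [/\ t' \in `[t, t + h], s' \in `[s, s + h] &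
    f (t + h) (s + h) - f (t + h) s - f t (s + h) + f t s = fst t' s' * h * h].
Proof.
move=> h0 H.
have tt : t \in `[t, t + h] by rewrite in_itv/= lexx lerDl.
have th : t + h \in `[t, t + h] by rewrite in_itv/= lexx lerDl h0.
have drv x : x \in `[s, s + h] ->
    is_derive x 1 (fun s' => f (t + h) s' - f t s') (fs (t + h) x - fs t x).
  by move=> xs; apply: is_deriveB; [exact: (H _ _ th xs).1|exact: (H _ _ tt xs).1].
have cs : {within `[s, s + h], continuous (fun s' => f (t + h) s' - f t s')}.
  by apply: derivable_within_continuous => x /drv[].
have sh : s <= s + h by rewrite lerDl.
have drvo x (xs : x \in `]s, s + h[) := drv x (subset_itv_oo_cc xs).
have [s' s's e1] := MVT_segment sh drvo cs.
have drv' x : x \in `[t, t + h] -> is_derive x 1 (fs^~ s') (fst x s').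
  by move=> xt; exact: (H _ _ xt s's).2.
have ct : {within `[t, t + h], continuous (fs^~ s')}.
  by apply: derivable_within_continuous => x /drv'[].
have th' : t <= t + h by rewrite lerDl.
have drvo' x (xs : x \in `]t, t + h[) := drv' x (subset_itv_oo_cc xs).
have [t' t't e2] := MVT_segment th' drvo' ct.
exists t', s'; split => //.
rewrite [t + h - t]addrAC subrr add0r in e2.
rewrite -e2; move: e1; rewrite [s + h - s]addrAC subrr add0r => <-; ring.
Qed.

(** * Functions of class C^1 on the strip [I] x R, their continuity and Schwarz's theorem *)

Section Partials.
Variables (R : realType) (I : set R).
Hypothesis openI : open I.

Lemma nbhs_strip (t s : R) : I t -> \forall p \near (t, s), I (p : R * R).1.
Proof.
move=> It; apply: (@cvg_fst _ _ (nbhs t) (nbhs s)); exact: open_nbhs_nbhs.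
Qed.

(** Continuity is local, and openness of [I] makes the strip a neighbourhood of each of its points;
    identities valid only over [I] can thus be used inside limits. *)
Lemma continuous_strip (V : topologicalType) (f g : R -> R -> V) t s : I t ->
  (forall t s, I t -> f t s = g t s) ->
  {for (t, s), continuous (fun p : R * R => f p.1 p.2)} ->
  {for (t, s), continuous (fun p : R * R => g p.1 p.2)}.
Proof.
move=> It fg; rewrite /prop_for /continuous_at/= -fg// => cf.
apply: cvg_trans cf; apply: near_eq_cvg.
by apply: filterS (nbhs_strip s It) => p /fg.
Qed.

Lemma eq_dt (V : normedModType R) (f g : R -> R -> V) t s : I t ->
  (forall t s, I t -> f t s = g t s) -> dt f t s = dt g t s.
Proof.
move=> It fg; rewrite /dt !derive1E; apply: near_eq_derive.
have : nbhs t I by exact: open_nbhs_nbhs.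
by apply: filterS => p /fg.
Qed.

Lemma eq_ds (V : normedModType R) (f g : R -> R -> V) t s : I t ->
  (forall t s, I t -> f t s = g t s) -> ds f t s = ds g t s.
Proof.
by move=> It fg; rewrite /ds; congr derive1; apply/funext => s'; exact: fg.
Qed.

(** The partial derivatives are carried as explicit functions, so that the calculus rules compose as
    terms and the derivatives of a compound expression are found by unification. *)
Definition has_partials (V : normedModType R) (f ft fs : R -> R -> V) :=
  forall t s, I t ->
   [/\ is_derive t 1 (f^~ s) (ft t s), is_derive s 1 (f t) (fs t s),
    {for (t, s), continuous (fun p : R * R => ft p.1 p.2)} &
    {for (t, s), continuous (fun p : R * R => fs p.1 p.2)}].

Section Vec.
Variable V : normedModType R.
Implicit Types f g ft fs : R -> R -> V.

Lemma C1_has_partials f : C1_on I f -> has_partials f (dt f) (ds f).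
Proof.
move=> fC t s It; have [ft fs ct cs] := fC t s It.
by split => //; rewrite /dt /ds derive1E; exact/derivableP.
Qed.

Lemma has_partials_dt f ft fs : has_partials f ft fs ->
  forall t s, I t -> dt f t s = ft t s.
Proof.
move=> H t s It; have [ft' _ _ _] := H t s It.
by rewrite /dt derive1E derive_val.
Qed.

Lemma has_partials_ds f ft fs : has_partials f ft fs ->
  forall t s, I t -> ds f t s = fs t s.
Proof.
move=> H t s It; have [_ fs' _ _] := H t s It.
by rewrite /ds derive1E derive_val.
Qed.

Lemma has_partials_C1 f ft fs : has_partials f ft fs -> C1_on I f.
Proof.
move=> H t s It; have [ft' fs' ct cs] := H t s It; split.
- by case: ft'.
- by case: fs'.
- by apply: (continuous_strip It) ct => a b Ia; rewrite (has_partials_dt H).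
- by apply: (continuous_strip It) cs => a b Ia; rewrite (has_partials_ds H).
Qed.

Lemma eq_C1 f g : (forall t s, I t -> f t s = g t s) -> C1_on I f -> C1_on I g.
Proof.
move=> fg /C1_has_partials H; apply: (@has_partials_C1 g (dt f) (ds f)) => t s It.
have [ft fs ct cs] := H t s It; split => //.
- apply: near_eq_is_derive ft.
  have : nbhs t I by exact: open_nbhs_nbhs.
  by apply: filterS => p /fg.
- suff <- : f t = g t by [].
  by apply/funext => s'; exact: fg.
Qed.

End Vec.

Lemma box_nbhs (t s : R) (P : R * R -> Prop) : (\forall p \near (t, s), P p) ->
  exists2 r, 0 < r & forall t' s', `|t - t'| < r -> `|s - s'| < r -> P (t', s').
Proof.
move=> /nbhs_ballP[r /= r0 rP]; exists r => // t' s' tr sr.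
by apply: rP; split.
Qed.

(** The path from [(t, s)] to [(t', s')] passes through [(t', s)]. The first leg is controlled by
    derivability in [t] at fixed [s], the second by [mvt_le] with a bound on [ds f] that is uniform
    over a box. *)
Lemma C1_continuous (f : R -> R -> R) t s : C1_on I f -> I t ->
  {for (t, s), continuous (fun p : R * R => f p.1 p.2)}.
Proof.
move=> /C1_has_partials H It.
have [ft _ _ cs] := H t s It.
have : \forall p \near (t, s), `|ds f t s - ds f p.1 p.2| < 1 /\ I p.1.
  apply: filterI; last exact: nbhs_strip.
  by move/cvgrPdist_lt : cs; apply.
move=> /box_nbhs[r r0 rP].
(* [M] bounds the norm of [ds f] on the whole box: the tolerance 1 chosen above is added to the
   value at the centre, which also makes [M] positive. *)
pose M := `|ds f t s| + 1.
have M0 : 0 < M by rewrite ltr_wpDl.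
have cf : {for t, continuous (f^~ s)}.
  by apply: differentiable_continuous; apply/derivable1_diffP; by case: ft.
apply/cvgrPdist_lt => e e0 /=.
have e2 : 0 < e / 2 by rewrite divr_gt0.
have A : \forall p \near (t, s), `|f t s - f p.1 s| < e / 2.
  have : nbhs t [set t' | `|f t s - f t' s| < e / 2].
    by move/cvgrPdist_lt : cf; exact.
  exact: (@cvg_fst _ _ (nbhs t) (nbhs s)).
have B : \forall p \near (t, s), `|t - p.1| < r.
  have : nbhs t [set t' | `|t - t'| < r] by exact: nbhsx_ballx.
  exact: (@cvg_fst _ _ (nbhs t) (nbhs s)).
(* The radius [e / 2 / M] makes the leg in [s], of size at most [M * |s - s'|], smaller than
   [e / 2]. *)
have C : \forall p \near (t, s), `|s - p.2| < Num.min r (e / 2 / M).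
  have : nbhs s [set s' | `|s - s'| < Num.min r (e / 2 / M)].
    by apply: (nbhsx_ballx s (Num.min r (e / 2 / M))); rewrite lt_min r0 divr_gt0.
  exact: (@cvg_snd _ _ (nbhs t) (nbhs s)).
apply: filterS3 A B C => -[t' s'] /= A B; rewrite lt_min => /andP[C1 C2].
have D : `|f t' s - f t' s'| <= M * `|s - s'|.
  apply: (@mvt_le _ (f t') (ds f t') s r) => // x sx.
  have [/= dM It'] := rP _ _ B sx; have [_ fs _ _] := H t' x It'.
  split => //.
  rewrite -[X in `|X|](subrK (ds f t s)) -/M addrC.
  by rewrite (le_trans (ler_normD _ _))// lerD2l distrC ltW.
rewrite -(subrKA (f t' s)) (le_lt_trans (ler_normD _ _))//.
rewrite [ltRHS]splitr ltrD// (le_lt_trans D)//.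
by rewrite mulrC -ltr_pdivlMr.
Qed.

(* Both mixed partials are, up to an arbitrarily small error, the same second
   difference of f over a small square. *)
Lemma schwarz (f ft fs : R -> R -> R) :
  (forall t s : R, I t -> is_derive t 1 (f^~ s) (ft t s)) ->
  (forall t s : R, I t -> is_derive s 1 (f t) (fs t s)) ->
  C1_on I ft -> C1_on I fs ->
  forall t s, I t -> ds ft t s = dt fs t s.
Proof.
move=> Dt Ds /C1_has_partials Ct /C1_has_partials Cs t s It.
apply/eqP; rewrite -subr_eq0 -normr_le0; apply/ler_addgt0Pl => e e0.
have e2 : 0 < e / 2 by rewrite divr_gt0.
have [_ _ _ cts] := Ct t s It; have [_ _ cst _] := Cs t s It.
have : \forall p \near (t, s), [/\ `|ds ft t s - ds ft p.1 p.2| < e / 2,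
    `|dt fs t s - dt fs p.1 p.2| < e / 2 & I p.1].
  move: cts cst => /cvgrPdist_lt/(_ _ e2) A /cvgrPdist_lt/(_ _ e2) B.
  by apply: filterS3 A B (nbhs_strip s It).
move=> /box_nbhs[r r0 rP].
(* Halving [r] keeps the closed square of side [h] inside the open box of radius [r]. *)
pose h := r / 2.
have h0 : 0 < h by rewrite divr_gt0.
have box c x : x \in `[c, c + h] -> `|c - x| < r.
  rewrite in_itv/= => /andP[cx xh]; rewrite ler0_norm ?subr_le0//.
  by move: xh h0; rewrite /h; lra.
have [t1 [s1 [t1h s1h E1]]] :
    exists t' s', [/\ t' \in `[t, t + h], s' \in `[s, s + h] &
    f (t + h) (s + h) - f (t + h) s - f t (s + h) + f t s = dt fs t' s' * h * h].
  apply: (double_difference_mvt (fs := fs)) (ltW h0) _ => t' s' /box Bt /box Bs.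
  have [_ _ It'] := rP _ _ Bt Bs; split; first exact: Ds.
  by have [] := Cs t' s' It'.
(* The same second difference with the two variables exchanged; only its two middle terms change
   places. *)
have [s2 [t2 [s2h t2h E2]]] :
    exists s' t', [/\ s' \in `[s, s + h], t' \in `[t, t + h] &
    f (t + h) (s + h) - f t (s + h) - f (t + h) s + f t s = ds ft t' s' * h * h].
  apply: (double_difference_mvt (f := fun s t => f t s)
    (fs := fun s t => ft t s) (fst := fun s t => ds ft t s)) (ltW h0) _
    => s' t' /box Bs /box Bt.
  have [_ _ It'] := rP _ _ Bt Bs; split; first exact: Dt.
  by have [] := Ct t' s' It'.
have E : dt fs t1 s1 = ds ft t2 s2.
  have /mulIf : h != 0 by rewrite gt_eqF.
  move=> hI; do 2 apply: (hI).
  by rewrite -E1 -E2; ring.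
have [_ B1 _] := rP _ _ (box _ _ t1h) (box _ _ s1h).
have [B2 _ _] := rP _ _ (box _ _ t2h) (box _ _ s2h).
rewrite /= in B1 B2.
rewrite -(subrKA (ds ft t2 s2)) addr0 (le_trans (ler_normD _ _))//.
by rewrite [leRHS]splitr lerD ?(ltW B2)// distrC -E ltW.
Qed.

End Partials.

(** * Calculus rules for real functions of class C^1 *)

Section Calculus.
Variables (R : realType) (I : set R).
Hypothesis openI : open I.
Implicit Types f g ft fs gt gs : R -> R -> R.

Lemma has_partials_cst (c : R) :
  has_partials I (fun _ _ => c) (fun _ _ => 0) (fun _ _ => 0).
Proof.
by move=> t s It; split; do ?[exact: is_derive_cst|exact: cvg_cst].
Qed.

Lemma has_partialsD f ft fs g gt gs :
  has_partials I f ft fs -> has_partials I g gt gs ->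
  has_partials I (fun t s => f t s + g t s)
    (fun t s => ft t s + gt t s) (fun t s => fs t s + gs t s).
Proof.
move=> Hf Hg t s It; have [ft' fs' cft cfs] := Hf t s It.
have [gt' gs' cgt cgs] := Hg t s It; split.
- exact: (is_deriveD ft' gt').
- exact: (is_deriveD fs' gs').
- exact: (continuousD cft cgt).
- exact: (continuousD cfs cgs).
Qed.

Lemma has_partialsN f ft fs : has_partials I f ft fs ->
  has_partials I (fun t s => - f t s) (fun t s => - ft t s) (fun t s => - fs t s).
Proof.
move=> Hf t s It; have [ft' fs' cft cfs] := Hf t s It; split.
- exact: (is_deriveN ft').
- exact: (is_deriveN fs').
- exact: (continuousN cft).
- exact: (continuousN cfs).
Qed.

Lemma has_partials_continuous f ft fs t s : has_partials I f ft fs -> I t ->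
  {for (t, s), continuous (fun p : R * R => f p.1 p.2)}.
Proof. by move=> /(has_partials_C1 openI); exact: C1_continuous. Qed.

Lemma has_partialsM f ft fs g gt gs :
  has_partials I f ft fs -> has_partials I g gt gs ->
  has_partials I (fun t s => f t s * g t s)
    (fun t s => f t s * gt t s + g t s * ft t s)
    (fun t s => f t s * gs t s + g t s * fs t s).
Proof.
move=> Hf Hg t s It; have [ft' fs' cft cfs] := Hf t s It.
have [gt' gs' cgt cgs] := Hg t s It.
(* The partials of a product contain [f] and [g] themselves, so their joint continuity is needed as
   well. *)
have cf := has_partials_continuous (s := s) Hf It.
have cg := has_partials_continuous (s := s) Hg It; split.
- exact: (is_deriveM ft' gt').
- exact: (is_deriveM fs' gs').
- exact: (continuousD (continuousM cf cgt) (continuousM cg cft)).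
- exact: (continuousD (continuousM cf cgs) (continuousM cg cfs)).
Qed.

(** The conditions on [phi] are imposed only at the values taken by [f] over [I], because the
    inverse and the square root are smooth only away from 0. *)
Lemma has_partials_comp (phi dphi : R -> R) f ft fs :
  (forall t s, I t -> is_derive (f t s) 1 phi (dphi (f t s))) ->
  (forall t s, I t -> {for f t s, continuous dphi}) ->
  has_partials I f ft fs ->
  has_partials I (fun t s => phi (f t s))
    (fun t s => dphi (f t s) * ft t s) (fun t s => dphi (f t s) * fs t s).
Proof.
move=> Dphi cphi Hf t s It; have [ft' fs' cft cfs] := Hf t s It.
have cf := has_partials_continuous (s := s) Hf It.
have cdf : {for (t, s), continuous (fun p : R * R => dphi (f p.1 p.2))}.
  exact: (continuous_comp cf (cphi t s It)).
split.
- exact: (is_derive1_comp (Dphi t s It) ft').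
- exact: (is_derive1_comp (Dphi t s It) fs').
- exact: (continuousM cdf cft).
- exact: (continuousM cdf cfs).
Qed.

Lemma C1V f : C1_on I f -> (forall t s, I t -> f t s != 0) ->
  C1_on I (fun t s => (f t s)^-1).
Proof.
move=> /C1_has_partials Hf f0; apply: (has_partials_C1 openI).
apply: (@has_partials_comp GRing.inv (fun x => - x ^- 2) _ _ _ _ _ Hf)
  => t s /(f0 t s) fn0.
- apply: is_derive_eq; first exact: (@is_deriveV _ id _ _ _ fn0 (is_derive_id _ _)).
  by rewrite /= /GRing.scale/= mulr1.
- apply: continuousN; apply: continuousV; first by rewrite expf_neq0.
  exact: exprn_continuous.
Qed.

Lemma C1_sqrt f : C1_on I f -> (forall t s, I t -> 0 < f t s) ->
  C1_on I (fun t s => Num.sqrt (f t s)).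
Proof.
move=> /C1_has_partials Hf f0; apply: (has_partials_C1 openI).
apply: (@has_partials_comp Num.sqrt (fun x => (2 * Num.sqrt x)^-1) _ _ _ _ _ Hf)
  => t s /(f0 t s) f_gt0.
- exact: is_derive1_sqrt.
- apply: continuousV; first by rewrite mulf_neq0// gt_eqF// sqrtr_gt0.
  by apply: continuousM; [exact: cvg_cst|exact: sqrt_continuous].
Qed.

Lemma has_partials_sum (J : Type) (r : seq J) (f ft fs : J -> R -> R -> R) :
  (forall i, has_partials I (f i) (ft i) (fs i)) ->
  has_partials I (fun t s => \sum_(i <- r) f i t s)
    (fun t s => \sum_(i <- r) ft i t s) (fun t s => \sum_(i <- r) fs i t s).
Proof.
move=> Hf; elim: r => [|j r IH].
  have nilE (h : J -> R -> R -> R) :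
      (fun t s => \sum_(i <- [::]) h i t s) = (fun _ _ => 0).
    by apply/funext => t; apply/funext => s; rewrite big_nil.
  by rewrite !nilE; exact: has_partials_cst.
have consE (h : J -> R -> R -> R) :
    (fun t s => \sum_(i <- j :: r) h i t s) =
    (fun t s => h j t s + \sum_(i <- r) h i t s).
  by apply/funext => t; apply/funext => s; rewrite big_cons.
by rewrite !consE; exact: has_partialsD.
Qed.

Lemma C1_cst (c : R) : C1_on I (fun _ _ => c).
Proof. exact: (has_partials_C1 openI (has_partials_cst c)). Qed.

Lemma C1D f g : C1_on I f -> C1_on I g -> C1_on I (fun t s => f t s + g t s).
Proof.
move=> /C1_has_partials Hf /C1_has_partials Hg.
exact: (has_partials_C1 openI (has_partialsD Hf Hg)).
Qed.

Lemma C1N f : C1_on I f -> C1_on I (fun t s => - f t s).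
Proof.
move=> /C1_has_partials Hf.
exact: (has_partials_C1 openI (has_partialsN Hf)).
Qed.

Lemma C1M f g : C1_on I f -> C1_on I g -> C1_on I (fun t s => f t s * g t s).
Proof.
move=> /C1_has_partials Hf /C1_has_partials Hg.
exact: (has_partials_C1 openI (has_partialsM Hf Hg)).
Qed.

Lemma C1_sum (J : finType) (f : J -> R -> R -> R) :
  (forall i, C1_on I (f i)) -> C1_on I (fun t s => \sum_i f i t s).
Proof.
move=> Hf; apply: (has_partials_C1 openI).
exact: (has_partials_sum (index_enum J) (fun i => C1_has_partials (Hf i))).
Qed.

End Calculus.

(** * Reduction of vector-valued functions to their coordinates *)

Section Coordinates.
Variables (R : realType) (I : set R) (d : nat).
Hypothesis openI : open I.
Implicit Types F : R -> R -> 'rV[R]_d.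

(** A neighbourhood of a row contains a product of neighbourhoods of its entries, and finitely many
    conditions hold near [x] together as soon as each does. *)
Lemma continuous_coord (T : topologicalType) (F : T -> 'rV[R]_d) (x : T) :
  (forall i, {for x, continuous (fun y => F y 0 i)}) -> {for x, continuous F}.
Proof.
move=> cF A [P MP PA].
have : \forall y \near x, forall i, P 0 i (F y 0 i).
  by apply: filter_forall => i; exact: (cF i (P 0 i) (MP 0 i)).
by apply: filterS => y Py; apply: PA => i j; rewrite ord1.
Qed.

Lemma derivable_coord (g : R -> 'rV[R]_d) x :
  derivable g x 1 <-> forall i, derivable (fun y => g y 0 i) x 1.
Proof.
split=> [/derivable_mxP H i|H]; first exact: H.
by apply/derivable_mxP => i j; rewrite ord1.
Qed.

Lemma derive1_coord (g : R -> 'rV[R]_d) x i : derivable g x 1 ->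
  derive1 g x 0 i = derive1 (fun y => g y 0 i) x.
Proof. by move=> gx; rewrite !derive1E derive_mx// mxE. Qed.

Lemma dt_coord F t s i : C1_on I F -> I t ->
  dt F t s 0 i = dt (fun t s => F t s 0 i) t s.
Proof.
move=> CF It; have [Ft _ _ _] := CF t s It.
exact: (@derive1_coord (fun t => F t s) t i Ft).
Qed.

Lemma ds_coord F t s i : C1_on I F -> I t ->
  ds F t s 0 i = ds (fun t s => F t s 0 i) t s.
Proof.
move=> CF It; have [_ Fs _ _] := CF t s It.
exact: (@derive1_coord (F t) s i Fs).
Qed.

(** Lets the regularity of vector fields be deduced from the scalar calculus rules above. *)
Lemma C1_coordP F :
  C1_on I F <-> forall i, C1_on I (fun t s => F t s 0 i).
Proof.
split=> [CF i t s It|CF t s It].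
  have [Ft Fs ct cs] := CF t s It; split.
  - by move/derivable_coord : Ft.
  - by move/derivable_coord : Fs.
  - apply: (continuous_strip openI It (fun a b => @dt_coord F a b i CF)).
    exact: (continuous_comp ct (@coord_continuous _ _ _ _ _ _)).
  - apply: (continuous_strip openI It (fun a b => @ds_coord F a b i CF)).
    exact: (continuous_comp cs (@coord_continuous _ _ _ _ _ _)).
(* Derivability over the whole strip comes first: a coordinate of [dt F] or [ds F] is the derivative
   of that coordinate only where [F] is derivable, and continuity of the partials concerns nearby
   points too. *)
have dF a b : I a -> derivable (F^~ b) a 1 /\ derivable (F a) b 1.
  by move=> Ia; split; apply/derivable_coord => i; have [] := CF i a b Ia.
split; [exact: (dF t s It).1|exact: (dF t s It).2| |];
  apply: continuous_coord => i; have [_ _ ct cs] := CF i t s It.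
- apply: (@continuous_strip _ _ openI _ _ (fun t s => dt F t s 0 i) _ _ It _ ct) => a b Ia.
  by apply: esym; exact: (@derive1_coord (fun t => F t b) a i (dF a b Ia).1).
- apply: (@continuous_strip _ _ openI _ _ (fun t s => ds F t s 0 i) _ _ It _ cs) => a b Ia.
  by apply: esym; exact: (@derive1_coord (F a) b i (dF a b Ia).2).
Qed.

End Coordinates.

(** * Pointwise algebra of the constraints and the transport laws *)

Lemma enorm_sq (R : realType) (d : nat) (u : 'rV[R]_d) : enorm u ^+ 2 = dot u u.
Proof. by rewrite sqr_sqrtr// sumr_ge0// => i _; rewrite -expr2 sqr_ge0. Qed.

(** Contraction of a transport law with a vector [x], solved for the time derivative; it serves for
    both laws, each contracted with [eta] and with [zeta]. *)
Lemma sum_transport (F : fieldType) (J : finType) (k v tau : F)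
    (x yt ys zs y : J -> F) :
  (forall i, yt i + v * ys i + tau * zs i = k * y i) ->
  \sum_i x i * yt i = k * (\sum_i x i * y i) - v * (\sum_i x i * ys i)
    - tau * (\sum_i x i * zs i).
Proof.
move=> H; rewrite !big_distrr/= -!sumrB; apply: eq_bigr => i _.
have -> : yt i = k * y i - v * ys i - tau * zs i by rewrite -H; ring.
ring.
Qed.

(** Everything happens at a single point: the derivatives are free scalars, tied only by the
    differentiated constraints and by the laws with residual [k]. *)
Lemma augmented_residual0 (F : fieldType) (J : finType)
    (k tau taut taus v vt vs : F) (eta etat etas zeta zetat zetas : J -> F) :
  tau != 0 ->
  tau * tau + v * v + \sum_i eta i * eta i + \sum_i zeta i * zeta i = 1 ->
  tau * v = \sum_i eta i * zeta i ->
  tau * taut + v * vt + \sum_i eta i * etat i + \sum_i zeta i * zetat i = 0 ->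
  tau * taus + v * vs + \sum_i eta i * etas i + \sum_i zeta i * zetas i = 0 ->
  tau * vt + v * taut = \sum_i eta i * zetat i + \sum_i zeta i * etat i ->
  tau * vs + v * taus = \sum_i eta i * zetas i + \sum_i zeta i * etas i ->
  taut + v * taus - tau * vs = tau * k ->
  (forall i, etat i + v * etas i + tau * zetas i = k * eta i) ->
  (forall i, zetat i + v * zetas i + tau * etas i = k * zeta i) ->
  k = 0 /\ vt + v * vs = tau * taus.
Proof.
move=> tau0 norm1 orth norm1t norm1s ortht orths Ek Eeta Ezeta.
rewrite (sum_transport eta Eeta) (sum_transport zeta Ezeta) in norm1t.
rewrite (sum_transport zeta Eeta) (sum_transport eta Ezeta) in ortht.
have swap : \sum_i zeta i * eta i = \sum_i eta i * zeta i.
  by apply: eq_bigr => i _; rewrite mulrC.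
rewrite swap -orth in ortht.
move: norm1 norm1t norm1s ortht orths Ek {orth swap Eeta Ezeta}.
set a := \sum_i eta i * eta i; set b := \sum_i zeta i * zeta i.
set as_ := \sum_i eta i * etas i; set bs := \sum_i zeta i * zetas i.
set m1 := \sum_i eta i * zetas i; set m2 := \sum_i zeta i * etas i.
move=> norm1 norm1t norm1s ortht orths Ek.
(* [e] is the defect in the equation for [v]; the goal is first [e = k * v], then [k = 0]. *)
pose e := vt + v * vs - tau * taus.
have tautE : taut = tau * k - v * taus + tau * vs by rewrite -Ek; ring.
have vtE : vt = e - v * vs + tau * taus by rewrite /e; ring.
(* This is the derivative of [tau * v = eta . zeta] along d_t + v d_s. The contracted laws leave
   [as_ + bs], which the s-derivative of the norm constraint eliminates. *)
have orthe : tau * (e - k * v) = 0.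
  have -> : tau * (e - k * v) = (tau * vt + v * taut)
      + v * (tau * vs + v * taus) - tau * (tau * taus + v * vs) - 2 * k * (tau * v).
    by rewrite tautE vtE; ring.
  rewrite ortht orths.
  have -> : tau * taus + v * vs = - as_ - bs.
    by apply/eqP; rewrite -subr_eq0 -norm1s; apply/eqP; ring.
  ring.
have eE : e = k * v.
  by apply/eqP; rewrite -subr_eq0 -(mulrI_eq0 _ (lregP tau0)) orthe.
have k0 : k = 0.
  have -> : k = k * 1 by rewrite mulr1.
  (* The [1] becomes the sum of squares and the [0] the differentiated norm constraint; after
     substitution of [taut], [vt], [m1] and [as_] the two sides agree identically. *)
  rewrite -norm1 -norm1t.
  rewrite tautE vtE eE.
  have -> : m1 = tau * vs + v * taus - m2 by rewrite orths; ring.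
  have -> : as_ = - (tau * taus + v * vs + bs).
    by apply/eqP; rewrite -subr_eq0 -norm1s; apply/eqP; ring.
  ring.
by split=> //; rewrite vtE eE k0; ring.
Qed.

(** * From the conservation laws to the augmented system *)

Section Conservation.
Variables (R : realType) (I : set R) (J : finType).
Hypothesis openI : open I.
Variables (rho tau v : R -> R -> R) (eta zeta : J -> R -> R -> R).
Hypothesis C1rho : C1_on I rho.
Hypothesis C1tau : C1_on I tau.
Hypothesis C1v : C1_on I v.
Hypothesis C1eta : forall i, C1_on I (eta i).
Hypothesis C1zeta : forall i, C1_on I (zeta i).
Hypothesis rho_tau : forall t s, I t -> rho t s * tau t s = 1.
Hypothesis norm1 : forall t s, I t ->
  tau t s * tau t s + v t s * v t s + \sum_i eta i t s * eta i t s
  + \sum_i zeta i t s * zeta i t s = 1.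
Hypothesis orth : forall t s, I t ->
  tau t s * v t s = \sum_i eta i t s * zeta i t s.
Hypothesis cons_eta : forall i t s, I t ->
  dt (fun t s => rho t s * eta i t s) t s
  + ds (fun t s => zeta i t s + v t s * (rho t s * eta i t s)) t s = 0.
Hypothesis cons_zeta : forall i t s, I t ->
  dt (fun t s => rho t s * zeta i t s) t s
  + ds (fun t s => v t s * (rho t s * zeta i t s) + eta i t s) t s = 0.

(** The product rule brings the constraints and the conservation laws into the form required by
    [augmented_residual0]; once [k] vanishes, the laws with residual become the equations for [tau],
    [eta] and [zeta]. *)
Lemma augmented_of_conservation t s : I t ->
  [/\ dt tau t s + v t s * ds tau t s = tau t s * ds v t s,
      dt v t s + v t s * ds v t s = tau t s * ds tau t s,
      forall i, dt (eta i) t s + v t s * ds (eta i) t s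
                = - (tau t s * ds (zeta i) t s) &
      forall i, dt (zeta i) t s + v t s * ds (zeta i) t s
                = - (tau t s * ds (eta i) t s)].
Proof.
move=> It.
have Hr := C1_has_partials C1rho; have Ht := C1_has_partials C1tau.
have Hv := C1_has_partials C1v; have He i := C1_has_partials (C1eta i).
have Hz i := C1_has_partials (C1zeta i).
have rt := rho_tau s It.
have tau0 : tau t s != 0.
  by apply: contra_eq_neq rt => ->; rewrite mulr0 eq_sym oner_eq0.
have Hcst (c : R) := @has_partials_cst R I c.
have Drt := has_partialsM openI Hr Ht.
have rtt : rho t s * dt tau t s + tau t s * dt rho t s = 0.
  rewrite -(has_partials_dt Drt s It) (eq_dt openI s It rho_tau).
  exact: (has_partials_dt (Hcst 1)).
have rts : rho t s * ds tau t s + tau t s * ds rho t s = 0.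
  rewrite -(has_partials_ds Drt s It) (eq_ds s It rho_tau).
  exact: (has_partials_ds (Hcst 1)).
have Dn := has_partialsD (has_partialsD (has_partialsD (has_partialsM openI Ht Ht)
  (has_partialsM openI Hv Hv))
  (has_partials_sum (index_enum J) (fun i => has_partialsM openI (He i) (He i))))
  (has_partials_sum (index_enum J) (fun i => has_partialsM openI (Hz i) (Hz i))).
have Do := has_partialsM openI Ht Hv.
have De := has_partials_sum (index_enum J)
  (fun i => has_partialsM openI (He i) (Hz i)).
(* Differentiating a square by the product rule gives each term twice. *)
have dbl (a b c e : R) :
    a + a + (b + b) + (c + c) + (e + e) = 0 -> a + b + c + e = 0.
  move=> H; lra.
have n1t : tau t s * dt tau t s + v t s * dt v t s
    + \sum_i eta i t s * dt (eta i) t s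
    + \sum_i zeta i t s * dt (zeta i) t s = 0.
  apply: dbl; rewrite -!big_split/=.
  rewrite -(has_partials_dt Dn s It) (eq_dt openI s It norm1).
  exact: (has_partials_dt (Hcst 1)).
have n1s : tau t s * ds tau t s + v t s * ds v t s
    + \sum_i eta i t s * ds (eta i) t s
    + \sum_i zeta i t s * ds (zeta i) t s = 0.
  apply: dbl; rewrite -!big_split/=.
  rewrite -(has_partials_ds Dn s It) (eq_ds s It norm1).
  exact: (has_partials_ds (Hcst 1)).
have ot : tau t s * dt v t s + v t s * dt tau t s =
    \sum_i eta i t s * dt (zeta i) t s + \sum_i zeta i t s * dt (eta i) t s.
  rewrite -big_split/= -(has_partials_dt Do s It) -(has_partials_dt De s It).
  exact: (eq_dt openI s It orth).
have os : tau t s * ds v t s + v t s * ds tau t s =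
    \sum_i eta i t s * ds (zeta i) t s + \sum_i zeta i t s * ds (eta i) t s.
  rewrite -big_split/= -(has_partials_ds Do s It) -(has_partials_ds De s It).
  exact: (eq_ds s It orth).
(* [k] is [- tau] times rho_t + (rho v)_s, the defect of the continuity equation for [rho]; since
   [rho * tau = 1], it satisfies the relation [Ek]. *)
pose k := - tau t s * (dt rho t s + v t s * ds rho t s + rho t s * ds v t s).
have Ek : dt tau t s + v t s * ds tau t s - tau t s * ds v t s = tau t s * k.
  rewrite /k.
  (* Inserting the factor [rho * tau = 1] makes the claim a combination of [rtt] and [rts] with
     polynomial coefficients, so [ring] suffices without division. *)
  have -> : dt tau t s = (rho t s * tau t s) * dt tau t s by rewrite rt mul1r.
  have -> : ds tau t s = (rho t s * tau t s) * ds tau t s by rewrite rt mul1r.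
  have -> : tau t s * ds v t s = (rho t s * tau t s) * (tau t s * ds v t s).
    by rewrite rt mul1r.
  apply/eqP; rewrite -subr_eq0; apply/eqP.
  transitivity (tau t s * (rho t s * dt tau t s + tau t s * dt rho t s)
    + tau t s * v t s * (rho t s * ds tau t s + tau t s * ds rho t s)); first by ring.
  by rewrite rtt rts; ring.
have Eeta i : dt (eta i) t s + v t s * ds (eta i) t s + tau t s * ds (zeta i) t s
    = k * eta i t s.
  have := cons_eta i s It.
  rewrite (has_partials_dt (has_partialsM openI Hr (He i)) s It).
  rewrite (has_partials_ds (has_partialsD (Hz i)
    (has_partialsM openI Hv (has_partialsM openI Hr (He i)))) s It) => E.
  have -> : dt (eta i) t s = (rho t s * tau t s) * dt (eta i) t s by rewrite rt mul1r.
  have -> : ds (eta i) t s = (rho t s * tau t s) * ds (eta i) t s by rewrite rt mul1r.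
  (* The difference of the two sides is [tau] times the expanded conservation law [E]. *)
  apply/eqP; rewrite -subr_eq0 -(mulr0 (tau t s)) -E /k; apply/eqP; ring.
have Ezeta i : dt (zeta i) t s + v t s * ds (zeta i) t s + tau t s * ds (eta i) t s
    = k * zeta i t s.
  have := cons_zeta i s It.
  rewrite (has_partials_dt (has_partialsM openI Hr (Hz i)) s It).
  rewrite (has_partials_ds (has_partialsD
    (has_partialsM openI Hv (has_partialsM openI Hr (Hz i))) (He i)) s It) => E.
  have -> : dt (zeta i) t s = (rho t s * tau t s) * dt (zeta i) t s by rewrite rt mul1r.
  have -> : ds (zeta i) t s = (rho t s * tau t s) * ds (zeta i) t s by rewrite rt mul1r.
  apply/eqP; rewrite -subr_eq0 -(mulr0 (tau t s)) -E /k; apply/eqP; ring.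
have [k0 Ev] := augmented_residual0 tau0 (norm1 s It) (orth s It)
  n1t n1s ot os Ek Eeta Ezeta.
rewrite k0 in Ek Eeta Ezeta; split=> // [|i|i].
- by apply/eqP; rewrite -subr_eq0 Ek mulr0.
- by apply/eqP; rewrite -addr_eq0 Eeta mul0r.
- by apply/eqP; rewrite -addr_eq0 Ezeta mul0r.
Qed.

End Conservation.

(** * The string in scalar coordinates, its conservation laws and the conclusion *)

Theorem proposition2p1 (R : realType) (d : nat) (hd : (1 <= d)%N)
    (I : set R) (openI : open I) (intervalI : is_interval I)
    (X : R -> R -> 'rV[R]_d) (XC2 : C2_on I X)
    (radicand_gt0 : forall t s, I t -> 0 < radicand X t s)
    (Xstring : string_equation X I) :
  augmented_solution I
    (string_tau X) (string_v X) (string_eta X) (string_zeta X) /\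
  forall t s, I t ->
    [/\ 0 < string_tau X t s,
        string_tau X t s ^+ 2 + string_v X t s ^+ 2
          + enorm (string_eta X t s) ^+ 2 + enorm (string_zeta X t s) ^+ 2 = 1 &
        string_tau X t s * string_v X t s
          = dot (string_eta X t s) (string_zeta X t s)].
Proof.
have [C1X C1dt C1ds] := XC2.
pose y (i : 'I_d) t s : R := ds X t s 0 i.
pose w (i : 'I_d) t s : R := - dt X t s 0 i.
(* Here [p] is 1 + |Y|^2, [q] is Y . W, [n] is |W|^2 and [a] is A = -L. Squares are written as
   products so that the C^1 rules apply as they stand. *)
pose p t s : R := 1 + \sum_i y i t s * y i t s.
pose q t s : R := \sum_i y i t s * w i t s.
pose n t s : R := \sum_i w i t s * w i t s.
pose a t s : R := Num.sqrt (p t s * (1 + - n t s) + q t s * q t s).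
pose rho t s : R := p t s * (a t s)^-1.
pose tau t s : R := a t s * (p t s)^-1.
pose v t s : R := q t s * (p t s)^-1.
pose eta (i : 'I_d) t s : R := tau t s * y i t s.
pose zeta (i : 'I_d) t s : R := w i t s + - (v t s * y i t s).
have C1y i : C1_on I (y i) by exact: (C1_coordP openI (ds X)).1.
have C1x i : C1_on I (fun t s => dt X t s 0 i) by exact: (C1_coordP openI (dt X)).1.
have C1w i : C1_on I (w i) by exact: (C1N openI (C1x i)).
have C1p : C1_on I p.
  exact: (C1D openI (C1_cst openI 1)
    (C1_sum openI (fun i => C1M openI (C1y i) (C1y i)))).
have C1q : C1_on I q.
  exact: (C1_sum openI (fun i => C1M openI (C1y i) (C1w i))).
have C1n : C1_on I n.
  exact: (C1_sum openI (fun i => C1M openI (C1w i) (C1w i))).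
have p_gt0 t s : 0 < p t s.
  by rewrite ltr_wpDr// sumr_ge0// => i _; rewrite -expr2 sqr_ge0.
have p_neq0 t s : p t s != 0 by rewrite gt_eqF.
have YYE t s : enorm (ds X t s) ^+ 2 = p t s - 1.
  by rewrite enorm_sq /p /dot addrAC subrr add0r.
have WWE t s : enorm (dt X t s) ^+ 2 = n t s.
  by rewrite enorm_sq /dot; apply: eq_bigr => i _; rewrite /w mulrNN.
have WW'E t s : enorm (string_W X t s) ^+ 2 = n t s.
  by rewrite enorm_sq /dot; apply: eq_bigr => i _; rewrite !mxE.
have qE t s : dot (string_Y X t s) (string_W X t s) = q t s.
  by rewrite /dot; apply: eq_bigr => i _; rewrite !mxE.
have qE' t s : dot (dt X t s) (ds X t s) = - q t s.
  rewrite /dot -sumrN; apply: eq_bigr => i _.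
  by rewrite /y /w mulrN opprK mulrC.
have radE t s : radicand X t s = p t s * (1 + - n t s) + q t s * q t s.
  by rewrite /radicand YYE WWE qE' sqrrN expr2 [1 + _]addrC subrK.
have AE t s : Defs.coefA X t s = a t s by rewrite /Defs.coefA radE.
have rad_gt0 t s : I t -> 0 < p t s * (1 + - n t s) + q t s * q t s.
  by move=> It; rewrite -radE; exact: radicand_gt0.
have a_gt0 t s : I t -> 0 < a t s by move=> It; rewrite sqrtr_gt0 rad_gt0.
have a_neq0 t s : I t -> a t s != 0 by move=> It; rewrite gt_eqF ?a_gt0.
have aaE t s : I t -> a t s * a t s = p t s * (1 - n t s) + q t s * q t s.
  by move=> It; rewrite -expr2 sqr_sqrtr// ltW ?rad_gt0.
have C1a : C1_on I a.
  exact: (C1_sqrt openI (C1D openI (C1M openI C1p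
    (C1D openI (C1_cst openI 1) (C1N openI C1n))) (C1M openI C1q C1q)) rad_gt0).
have C1pV : C1_on I (fun t s => (p t s)^-1).
  exact: (C1V openI C1p (fun t s _ => p_neq0 t s)).
have C1rho : C1_on I rho by exact: (C1M openI C1p (C1V openI C1a a_neq0)).
have C1tau : C1_on I tau by exact: (C1M openI C1a C1pV).
have C1v : C1_on I v by exact: (C1M openI C1q C1pV).
have C1eta i : C1_on I (eta i) by exact: (C1M openI C1tau (C1y i)).
have C1zeta i : C1_on I (zeta i).
  exact: (C1D openI (C1w i) (C1N openI (C1M openI C1v (C1y i)))).
have tauE : string_tau X = tau.
  apply/funext => t; apply/funext => s.
  rewrite /string_tau /string_L opprK qE WW'E YYE.
  by rewrite [1 + (_ - 1)]addrC subrK expr2.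
have vE : string_v X = v.
  apply/funext => t; apply/funext => s.
  by rewrite /string_v qE YYE [1 + (_ - 1)]addrC subrK.
have etaE t s i : string_eta X t s 0 i = eta i t s.
  by rewrite /string_eta -/(string_tau X t s) tauE mxE.
have zetaE t s i : string_zeta X t s 0 i = zeta i t s.
  by rewrite /string_zeta -/(string_v X t s) vE !mxE.
have pm1 t s : \sum_i y i t s * y i t s = p t s - 1.
  by rewrite /p addrAC subrr add0r.
have ee t s : \sum_i eta i t s * eta i t s = tau t s * tau t s * (p t s - 1).
  by rewrite -pm1 big_distrr/=; apply: eq_bigr => i _; rewrite /eta; ring.
have zz t s : \sum_i zeta i t s * zeta i t s =
    n t s - 2 * v t s * q t s + v t s * v t s * (p t s - 1).
  rewrite -pm1 !big_distrr/= -sumrB -big_split/=; apply: eq_bigr => i _.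
  by rewrite /zeta; ring.
have ez t s : \sum_i eta i t s * zeta i t s =
    tau t s * q t s - tau t s * v t s * (p t s - 1).
  rewrite -pm1 !big_distrr/= -sumrB; apply: eq_bigr => i _.
  by rewrite /zeta /eta; ring.
have norm1 t s : I t -> tau t s * tau t s + v t s * v t s
    + \sum_i eta i t s * eta i t s + \sum_i zeta i t s * zeta i t s = 1.
  move=> It; rewrite ee zz.
  (* With the sums inserted, [tau] contributes tau^2 p = a^2 / p, and [v] contributes v^2 p - 2 v q
     = - q^2 / p. By [aaE] the quotient is 1 - n. *)
  transitivity ((a t s * a t s - q t s * q t s) / p t s + n t s).
    by rewrite /tau /v; field.
  by rewrite aaE//; field.
have orth t s : I t -> tau t s * v t s = \sum_i eta i t s * zeta i t s.
  by move=> It; rewrite ez /tau /v; field.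
have rho_tau t s : I t -> rho t s * tau t s = 1.
  by move=> It; rewrite /rho /tau; field; rewrite p_neq0 a_neq0.
have cons_eta i t s : I t -> dt (fun t s => rho t s * eta i t s) t s
    + ds (fun t s => zeta i t s + v t s * (rho t s * eta i t s)) t s = 0.
  move=> It.
  have e1 t' s' : I t' -> rho t' s' * eta i t' s' = y i t' s'.
    by move=> It'; rewrite mulrA rho_tau// mul1r.
  rewrite (eq_dt openI s It e1).
  rewrite (@eq_ds _ _ _ _ (w i) _ _ It); last first.
    by move=> t' s' It'; rewrite e1// subrK.
  rewrite (has_partials_ds (has_partialsN (C1_has_partials (C1x i))) s It).
  have C1Xi : C1_on I (fun t s => X t s 0 i) by exact: (C1_coordP openI X).1.
  have D1 t' s' : I t' -> is_derive t' (1 : R) (fun t => X t s' 0 i) (dt X t' s' 0 i).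
    move=> It'; rewrite (dt_coord s' i C1X It').
    by have [] := C1_has_partials C1Xi s' It'.
  have D2 t' s' : I t' -> is_derive s' (1 : R) (fun s => X t' s 0 i) (y i t' s').
    move=> It'; rewrite /y (ds_coord s' i C1X It').
    by have [] := C1_has_partials C1Xi s' It'.
  have -> := @schwarz _ _ openI (fun t s => X t s 0 i) _ _ D1 D2 (C1x i) (C1y i) t s It.
  by rewrite subrr.
have cons_zeta i t s : I t -> dt (fun t s => rho t s * zeta i t s) t s
    + ds (fun t s => v t s * (rho t s * zeta i t s) + eta i t s) t s = 0.
  move=> It.
  (* Unqualified [coefB], [coefC], [coefD] are lemmas about polynomials. *)
  pose F t' s' := Defs.coefB X t' s' *: dt X t' s'
    - Defs.coefC X t' s' *: ds X t' s'.
  pose G t' s' := Defs.coefC X t' s' *: dt X t' s'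
    + Defs.coefD X t' s' *: ds X t' s'.
  (* Since W = - X_t, [coefC] equals - q / a while [coefB] is [rho]; hence the minus sign here, and
     the string equation is the law for [zeta] with its sign reversed. *)
  have FE j t' s' : I t' -> - (rho t' s' * zeta j t' s') = F t' s' 0 j.
    move=> It'; rewrite !mxE /Defs.coefB /Defs.coefC YYE qE' AE /zeta /rho /v.
    by rewrite /w /y; field; rewrite p_neq0 a_neq0.
  have GE j t' s' : I t' -> v t' s' * (rho t' s' * zeta j t' s') + eta j t' s'
      = G t' s' 0 j.
    move=> It'; rewrite !mxE /Defs.coefD /Defs.coefC WWE qE' AE.
    have -> : 1 - n t' s' = (a t' s' * a t' s' - q t' s' * q t' s') / p t' s'.
      by rewrite aaE//; field.
    by rewrite /eta /zeta /rho /v /tau /w /y; field; rewrite p_neq0 a_neq0.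
  (* The string equation says nothing about derivability of [F] and [G], as [dt] and [ds] are total.
     It is inherited from the scalar expressions, and allows the equation to be read coordinate by
     coordinate. *)
  have C1rz j : C1_on I (fun t s => rho t s * zeta j t s).
    exact: (C1M openI C1rho (C1zeta j)).
  have C1F : C1_on I F.
    apply/(C1_coordP openI) => j; apply: (eq_C1 openI (FE j)).
    exact: (C1N openI (C1rz j)).
  have C1G : C1_on I G.
    apply/(C1_coordP openI) => j; apply: (eq_C1 openI (GE j)).
    exact: (C1D openI (C1M openI C1v (C1rz j)) (C1eta j)).
  have := Xstring t s It; rewrite -/F -/G => /(congr1 (fun m : 'rV_d => m 0 i)).
  rewrite !mxE (dt_coord s i C1F It) (ds_coord s i C1G It).
  rewrite -(eq_dt openI s It (FE i)) -(eq_ds s It (GE i)).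
  rewrite (has_partials_dt (has_partialsN (C1_has_partials (C1rz i))) s It).
  by rewrite -opprD => /eqP; rewrite oppr_eq0 => /eqP.
have aug t s := augmented_of_conservation openI C1rho C1tau C1v C1eta C1zeta
  rho_tau norm1 orth cons_eta cons_zeta (t := t) s.
have C1veta : C1_on I (string_eta X).
  by apply/(C1_coordP openI) => i; apply: (eq_C1 openI _ (C1eta i)) => t s _.
have C1vzeta : C1_on I (string_zeta X).
  by apply/(C1_coordP openI) => i; apply: (eq_C1 openI _ (C1zeta i)) => t s _.
have rowE (a1 a2 b : 'rV[R]_d) (f1 f2 g : 'I_d -> R) (c1 c2 : R) :
    (forall i, a1 0 i = f1 i) -> (forall i, a2 0 i = f2 i) ->
    (forall i, b 0 i = g i) -> (forall i, f1 i + c1 * f2 i = - (c2 * g i)) ->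
    a1 + c1 *: a2 = - (c2 *: b).
  by move=> E1 E2 E E12; apply/rowP => i; rewrite !mxE E1 E2 E.
have etaF i : (fun t s => string_eta X t s 0 i) = eta i.
  by apply/funext => t; apply/funext => s.
have zetaF i : (fun t s => string_zeta X t s 0 i) = zeta i.
  by apply/funext => t; apply/funext => s.
split; [split; first by rewrite tauE vE; split|] => t s It.
  have [Et Ev Eeta Ezeta] := aug t s It.
  have e1 i : dt (string_eta X) t s 0 i = dt (eta i) t s.
    by rewrite (dt_coord s i C1veta It) etaF.
  have e2 i : ds (string_eta X) t s 0 i = ds (eta i) t s.
    by rewrite (ds_coord s i C1veta It) etaF.
  have z1 i : dt (string_zeta X) t s 0 i = dt (zeta i) t s.
    by rewrite (dt_coord s i C1vzeta It) zetaF.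
  have z2 i : ds (string_zeta X) t s 0 i = ds (zeta i) t s.
    by rewrite (ds_coord s i C1vzeta It) zetaF.
  rewrite tauE vE; split.
  - exact: Et.
  - exact: Ev.
  - exact: (rowE _ _ _ _ _ _ _ _ e1 e2 z2 Eeta).
  - exact: (rowE _ _ _ _ _ _ _ _ z1 z2 e2 Ezeta).
have sumE (u u' : 'rV[R]_d) (f g : 'I_d -> R) : (forall i, u 0 i = f i) ->
    (forall i, u' 0 i = g i) -> dot u u' = \sum_i f i * g i.
  by move=> uf ug; apply: eq_bigr => i _; rewrite uf ug.
rewrite tauE vE !enorm_sq; split.
- by rewrite divr_gt0 ?a_gt0.
- rewrite (sumE _ _ _ _ (etaE t s) (etaE t s))
    (sumE _ _ _ _ (zetaE t s) (zetaE t s)).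
  by rewrite !expr2 norm1.
- by rewrite (sumE _ _ _ _ (etaE t s) (zetaE t s)) orth.
Qed.
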